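(* Let $X$ be a Banach space. Then the set of Lipschitz maps in $\mathrm{Lip}_0(X,X)$ that attain their Lipschitz numerical radius is not dense in $\mathrm{Lip}_0(X,X)$ (with respect to the norm $\|\cdot\|_L$).
   Context: $X$ is a real or complex Banach space with dual $X^*$. $\mathrm{Lip}_0(X,X)$ is the space of Lipschitz maps $T:X\to X$ with $T(0)=0$, with norm $\|T\|_L=\sup\{\|Tx-Ty\|/\|x-y\| : x\ne y\}$. For $x\in X$, $D(x)=\{x^*\in X^*: x^*(x)=\|x^*\|\|x\|=\|x\|^2\}$, and $\Pi=\{(x,y,x^* )\in X\times X\times X^* : x\neq y,\ x^*\in D(x-y)\}$. The Lipschitz numerical radius of $T\in\mathrm{Lip}_0(X,X)$ is $\nu_L(T)=\sup\left\{\frac{|x^*(Tx-Ty)|}{\|x-y\|^2}: (x,y,x^* )\in\Pi\right\}$. $T$ attains its Lipschitz numerical radius if this supremum is attained at some $(x,y,x^* )\in\Pi$. *)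

(* Defs.v *)
From HB Require Import structures.
From mathcomp Require Import all_boot all_order all_algebra.
From mathcomp Require Import all_classical all_reals all_analysis.
From mathcomp Require Import complex.

Set Implicit Arguments.
Unset Strict Implicit.
Unset Printing Implicit Defensive.

Import Order.TTheory GRing.Theory Num.Theory.
Import numFieldNormedType.Exports.

Local Open Scope classical_set_scope.
Local Open Scope ring_scope.

(* The scalar field K is meant to be R or R[i] for a realType R.  Norms on a
   normedModType K take values in K, so suprema of sets of norms are least upper
   bounds for the (for R[i], partial) order of K.  In R[i], z <= w means that
   w - z is a nonnegative real; hence every upper bound of a nonempty set of
   reals is real, and the least upper bound in R[i] is the usual one of R. *)

Section LipschitzNumericalRadius.
Variables (K : numFieldType) (X : normedModType K).

Record dual := Dual {
  dual_fun :> {linear X -> K^o};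
  dual_continuous : continuous dual_fun }.

Definition dual_norm (f : dual) : K :=
  supremum 0 [set `|f x| | x in [set x : X | `|x| <= 1]].

Definition Lip0 : set (X -> X) := [set T | T 0 = 0 /\ lipschitz T].

Definition lip_norm (T : X -> X) : K :=
  supremum 0 [set `|T p.1 - T p.2| / `|p.1 - p.2|
             | p in [set p : X * X | p.1 != p.2]].

Definition duality_map (x : X) : set dual :=
  [set f : dual | f x = dual_norm f * `|x| /\ dual_norm f * `|x| = `|x| ^+ 2].

Definition lip_states : set (X * X * dual) :=
  [set p | p.1.1 != p.1.2 /\ duality_map (p.1.1 - p.1.2) p.2].

Definition lip_quotient (T : X -> X) (p : X * X * dual) : K :=
  `|p.2 (T p.1.1 - T p.1.2)| / `|p.1.1 - p.1.2| ^+ 2.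

(* If X = {0}, then lip_states is empty, the supremum is 0 by convention and no
   map attains its Lipschitz numerical radius. *)
Definition lip_numerical_radius (T : X -> X) : K :=
  supremum 0 (lip_quotient T @` lip_states).

Definition attains_lip_numerical_radius (T : X -> X) : Prop :=
  exists2 p, lip_states p & lip_quotient T p = lip_numerical_radius T.

Definition lip_dense (A : set (X -> X)) : Prop :=
  forall S, Lip0 S -> forall e : K, 0 < e ->
    exists2 T, A T & lip_norm (S \- T) < e.

End LipschitzNumericalRadius.

(* Main.v *)
(** A map T attaining its Lipschitz numerical radius nu at (x, y, x^* ) attains
    it along the whole segment from y to x: by the triangle inequality
    |x^*(Tz - Tw)| = nu |z - w| |x - y| for all z, w on it.  Fix a state
    (a, b, u), put e := a - b and S v := f(Re u(v) / |e|^2) e, where f is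
    1-Lipschitz, nonconstant, but constant on a subinterval of every interval
    (the primitive of the indicator of a fat Cantor set).  Every segment contains
    a subsegment at whose endpoints S takes the same value, so a map close to S
    that attains its radius has a small radius; but its quotient at (e, 0, u) is
    close to f(1) > 0. *)

Require Import Defs.
From HB Require Import structures.
From mathcomp Require Import all_boot all_order all_algebra.
From mathcomp Require Import all_classical all_reals all_analysis.
From mathcomp Require Import complex ring lra.

Set Implicit Arguments.
Unset Strict Implicit.
Unset Printing Implicit Defensive.

Import Order.TTheory GRing.Theory Num.Theory.
Import numFieldNormedType.Exports.

Local Open Scope classical_set_scope.
Local Open Scope ring_scope.

(** * A fat Cantor set and the primitive of its indicator *)

(** [U] is a union of intervals centred at the rationals, with geometrically decreasing radii:
    density of the rationals makes it meet every interval in a subinterval, while countable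
    subadditivity keeps it small. *)
Lemma small_measure_dense_intervals (R : realType) :
  exists U : set R, [/\ measurable U, (lebesgue_measure U <= (2^-1)%:E)%E &
    forall a b, a < b -> exists s t, [/\ a <= s, s < t, t <= b & `[s, t] `<=` U]].
Proof.
pose r n : R := 8^-1 / (2 ^ n.+1)%:R.
have r_gt0 n : 0 < r n by rewrite divr_gt0 ?invr_gt0// ltr0n expn_gt0.
(* Every rational is listed at its own code; a number coding no rational only adds an interval
   around 0. *)
pose q n : R := ratr (odflt 0 (unpickle n)).
pose B n := `[q n - r n, q n + r n]%classic.
have mB n : measurable (B n) by exact: measurable_itv.
have mU : measurable (\bigcup_n B n) by exact: bigcup_measurable.
exists (\bigcup_n B n); split=> //.
- apply: (@le_trans _ _ (\sum_(0 <= n <oo) lebesgue_measure (B n))%E).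
    exact: measure_sigma_subadditive.
  apply: le_trans (epsilon_trick0 xpredT (_ : 0 <= 2^-1)); last by lra.
  apply: lee_nneseries => n _ //.
  rewrite lebesgue_measure_itv/= lte_fin; have := r_gt0 n => rn.
  case: ifPn => [_|]; rewrite ?EFinN -?EFinD lee_fin /r in rn *; lra.
- move=> a b ab; have [p] := rat_in_itvoo ab; rewrite in_itv/= => /andP[ap pb].
  pose n := pickle p; have qn : q n = ratr p by rewrite /q /n pickleK.
  (* This is the part of [B n] inside [[a, b]]; it has positive length because [ratr p] is interior
     to both. *)
  exists (Num.max a (ratr p - r n)), (Num.min b (ratr p + r n)).
  have := r_gt0 n => rn; split.
  + by rewrite le_max lexx.
  + by rewrite gt_max !lt_min; apply/andP; split; apply/andP; split; lra.
  + by rewrite ge_min lexx.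
  + move=> x /=; rewrite in_itv/= ge_max le_min => /andP[/andP[_ x1] /andP[_ x2]].
    by exists n => //=; rewrite /B /= in_itv/= qn x1 x2.
Qed.

(** The function is the measure of [[0, x]] minus [U]. Moving [x] inside [U] gains no measure, which
    gives the flat pieces, and at 1 at least half of the unit interval survives. *)
Lemma fat_cantor_function (R : realType) :
  exists f : R -> R, [/\ f 0 = 0, 0 < f 1,
    forall x y, `|f x - f y| <= `|x - y| &
    forall a b, a < b ->
      exists s t, [/\ a <= s, s < t, t <= b & f s = f t]].
Proof.
have [U [mU U_half U_dense]] := small_measure_dense_intervals R.
pose E (x : R) := `[0, x]%classic `\` U.
have mE x : measurable (E x) by apply: measurableD => //; exact: measurable_itv.
have mu_le (A B : set R) : measurable A -> measurable B -> A `<=` B ->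
    (lebesgue_measure A <= lebesgue_measure B)%E.
  by move=> mA mB; apply: (@le_measure _ _ _ (@lebesgue_measure R)); rewrite ?inE.
have E_itv x : (lebesgue_measure (E x) <= lebesgue_measure `[0%R, x]%classic)%E.
  by apply: mu_le; [exact: mE|exact: measurable_itv|move=> z []].
have E_fin x : lebesgue_measure (E x) \is a fin_num.
  rewrite ge0_fin_numE ?measure_ge0//; apply: le_lt_trans (E_itv x) _.
  by rewrite lebesgue_measure_itv/=; case: ifP => _; rewrite ?ltry// -EFinD ltry.
pose f x := fine (lebesgue_measure (E x)).
have fE x : (f x)%:E = lebesgue_measure (E x) by rewrite fineK.
have f_step x y : x <= y -> f x <= f y <= f x + (y - x).
  move=> xy; apply/andP; split; rewrite -lee_fin.
    rewrite !fE; apply: mu_le => // z [/=]; rewrite in_itv/= => /andP[z0 zx] nU.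
    by split=> //=; rewrite in_itv/= z0 (le_trans zx xy).
  rewrite EFinD !fE.
  have -> : ((y - x)%:E = lebesgue_measure `]x, y]%classic)%E.
    rewrite lebesgue_measure_itv/= lte_fin; case: ltP => // yx.
    by rewrite (@le_anti _ _ x y) ?xy// subrr.
  (* [E y] is covered by [E x] and []x, y]], also when [x] is negative and [E x] is empty. *)
  apply: le_trans (measureU2 (@lebesgue_measure R) (mE x) (measurable_itv _)).
  apply: mu_le => //.
    by apply: measurableU => //; exact: measurable_itv.
  move=> z [/=]; rewrite in_itv/= => /andP[z0 zy] nU.
  by case: (leP z x) => zx; [left; split=> //|right]; rewrite /= in_itv/= ?z0 ?zx ?zy.
have f0 : f 0 = 0.
  apply/eqP; rewrite eq_le -!lee_fin fE measure_ge0 andbT.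
  apply: le_trans (E_itv 0) _; by rewrite lebesgue_measure_itv/= lte_fin ltxx.
exists f; split=> //.
- have : (1%:E <= (f 1)%:E + (2^-1)%:E :> \bar R)%E.
    rewrite fE; apply: le_trans (leeD2l _ U_half).
    apply: le_trans (measureU2 (@lebesgue_measure R) (mE 1) mU).
    have {1}-> : (1%:E = lebesgue_measure (`[0%R, 1%R]%classic : set R))%E.
      by rewrite lebesgue_measure_itv/= lte_fin ltr01 -EFinD subr0.
    apply: mu_le => //.
      exact: measurableU.
    by move=> z z01; have [Uz|nUz] := pselect (U z); [right|left].
  rewrite -EFinD lee_fin; lra.
- move=> x y; case: (leP x y) => [xy|/ltW yx].
    rewrite distrC [leRHS]distrC; have /andP[fxy fyx] := f_step _ _ xy.
    by rewrite !ger0_norm ?subr_ge0//; lra.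
  have /andP[fxy fyx] := f_step _ _ yx.
  by rewrite !ger0_norm ?subr_ge0//; lra.
- move=> a b ab; have [s [t [as_ st tb stU]]] := U_dense _ _ ab.
  exists s, t; split=> //; rewrite /f; congr (fine (lebesgue_measure _)).
  apply/seteqP; split=> z [/=]; rewrite in_itv/= => /andP[z0 zs] nU; split=> //=;
    rewrite in_itv/= z0/=.
    by rewrite (le_trans zs (ltW st)).
  by rewrite leNgt; apply/negP => sz; apply: nU; apply: stU; rewrite /= in_itv/= (ltW sz).
Qed.

(** Flat subintervals are pulled back along [r] to [x + r * d]. A negative [d] reverses orientation
    and swaps the endpoints; for [d = 0] the whole unit interval serves. *)
Lemma constant_chord (R : realType) (f : R -> R) :
  (forall a b, a < b -> exists s t, [/\ a <= s, s < t, t <= b & f s = f t]) ->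
  forall x d, exists s t,
    [/\ 0 <= s, s < t, t <= 1 & f (x + s * d) = f (x + t * d)].
Proof.
move=> f_flat x d; case: (ltgtP d 0) => [d0|d0|->].
- have [|s [t [xs st tx fst]]] := f_flat (x + d) x; first by rewrite gtrDl.
  exists ((t - x) / d), ((s - x) / d).
  rewrite !divfK ?lt_eqF// ![x + _]addrC !subrK fst; split=> //.
  + by rewrite ler_ndivlMr// mul0r subr_le0.
  + by rewrite ltr_nM2r ?invr_lt0// ltrD2r.
  + by rewrite ler_ndivrMr// mul1r lerBrDl.
- have [|s [t [xs st tx fst]]] := f_flat x (x + d); first by rewrite ltrDl.
  exists ((s - x) / d), ((t - x) / d).
  rewrite !divfK ?gt_eqF// ![x + _]addrC !subrK fst; split=> //.
  + by rewrite divr_ge0 ?subr_ge0// ltW.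
  + by rewrite ltr_pM2r ?invr_gt0// ltrD2r.
  + by rewrite ler_pdivrMr// mul1r lerBlDl.
- by exists 0, 1; rewrite !mulr0.
Qed.

(** * Suprema and the passage between real and complex scalars *)

Section Supremum.
Context (d : Order.disp_t) (T : porderType d) (x0 : T).
Implicit Types (E : set T) (s : T).

Lemma supremumE E s : E !=set0 -> supremums E s -> supremum x0 E = s.
Proof.
move=> E0 Es; rewrite /supremum ifN; last exact/set0P.
by apply: (is_subset1_supremums _ Es); apply: xgetPex; exists s; exact: Es.
Qed.

Lemma supremum_supremums E : supremum x0 E != x0 -> supremums E (supremum x0 E).
Proof.
rewrite /supremum; case: ifPn => [_|_]; first by rewrite eqxx.
by case: xgetP => [c -> //|_]; rewrite eqxx.
Qed.

End Supremum.

(* The features shared by [R] and [R[i]] as scalar fields. *)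
Record real_part (R : realType) (K : numFieldType) := RealPart {
  of_real :> {rmorphism R -> K};
  re : K -> R;
  of_real_le : forall x y, (of_real x <= of_real y) = (x <= y);
  reB : forall z w, re (z - w) = re z - re w;
  reMl : forall a z, re (of_real a * z) = a * re z;
  of_real_re : forall z, 0 <= z -> of_real (re z) = z;
  re_norm : forall z, of_real `|re z| <= `|z| }.

Section RealPartTheory.
Variables (R : realType) (K : numFieldType) (j : real_part R K).

Lemma of_real_norm x : `|j x| = j `|x|.
Proof.
case: (leP 0 x) => [x0|/ltW x0].
  by rewrite !ger0_norm// -(rmorph0 j) of_real_le.
by rewrite !ler0_norm ?rmorphN// -(rmorph0 j) of_real_le.
Qed.

Lemma of_real_lt x y : (j x < j y) = (x < y).
Proof. by rewrite !lt_neqAle of_real_le (inj_eq (fmorph_inj j)). Qed.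

Lemma supremum_ubound (E : set K) : (forall z, E z -> 0 <= z) ->
  has_ubound E -> ubound E (supremum 0 E).
Proof.
move=> E_ge0 [b ub_b] z Ez.
have E_re w : E w -> j (re j w) = w by move=> /E_ge0; exact: of_real_re.
have b_re : j (re j b) = b.
  by apply: of_real_re; apply: le_trans (ub_b _ Ez); exact: E_ge0.
have re_ub c : 0 <= c -> ubound E c -> ubound (re j @` E) (re j c).
  move=> c0 ub_c _ [w Ew <-]; rewrite -(of_real_le j) E_re//.
  by rewrite (of_real_re j c0); exact: ub_c.
have re_E0 : re j @` E !=set0 by exists (re j z), z.
(* The order of [K] may be partial, so the supremum is formed in [R] and carried back; upper bounds
   of the nonempty nonnegative set [E] are themselves nonnegative, hence come from [R]. *)
suff E_sup : supremums E (j (sup (re j @` E))).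
  rewrite (supremumE _ _ E_sup); last by exists z.
  by case: E_sup => ub _; exact: ub.
split.
  move=> w Ew; rewrite -(E_re _ Ew) of_real_le; apply: ub_le_sup; last by exists w.
  exists (re j b); apply: re_ub => //.
  by apply: le_trans (ub_b _ Ez); exact: E_ge0.
move=> c ub_c; have c0 : 0 <= c by apply: le_trans (ub_c _ Ez); exact: E_ge0.
by rewrite -(of_real_re j c0) of_real_le; apply: ge_sup => //; exact: re_ub.
Qed.

End RealPartTheory.

(** * Duality map and Lipschitz constants *)

Section Duality.
Variables (K : numFieldType) (X : normedModType K).
Implicit Types (f : dual X) (x : X).

(** Membership forces the dual norm to be the norm of [x], so the supremum can be traded for a
    pointwise bound. *)
Lemma duality_mapP x f : x != 0 -> duality_map x f <->
  f x = `|x| ^+ 2 /\ forall v, `|f v| <= `|x| * `|v|.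
Proof.
move=> x0; have nx : 0 < `|x| by rewrite normr_gt0.
have nx0 : `|x| != 0 by rewrite gt_eqF.
pose E := [set `|f v| | v in [set v : X | `|v| <= 1]].
split=> [[fx fxx]|[fx f_le]].
  have fn : dual_norm f = `|x|.
    by apply: (mulIf nx0); rewrite fxx expr2.
  split; first by rewrite fx fxx.
  (* [supremum] returns 0 when no least upper bound exists, so a nonzero value
     is a genuine one. *)
  have [ub _] : supremums E `|x|.
    by rewrite -fn; apply: supremum_supremums; rewrite -/(dual_norm f) fn.
  move=> v; have [->|v0] := eqVneq v 0.
    by rewrite linear0 !normr0 mulr0.
  have nv : 0 < `|v| by rewrite normr_gt0.
  have : `|f (`|v|^-1 *: v)| <= `|x|.
    apply: ub; exists (`|v|^-1 *: v) => //=.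
    by rewrite normrZ normfV normr_id mulVf ?gt_eqF.
  by rewrite linearZ normrM normfV normr_id ler_pdivrMl// mulrC.
have fn : dual_norm f = `|x|.
  (* The normalised [x] realises the bound, so it is a maximum and therefore a least upper bound. *)
  have Ex : E `|x|.
    exists (`|x|^-1 *: x) => /=.
      by rewrite normrZ normfV normr_id mulVf.
    by rewrite linearZ fx normrM normfV normr_id normrX normr_id expr2 mulKf.
  have supx : supremums E `|x|.
    split=> [_ [v /= v1 <-]|c]; last exact.
    by apply: le_trans (f_le v) _; rewrite ler_piMr.
  by apply: supremumE supx; exists `|x|.
by rewrite /duality_map /= fn fx expr2.
Qed.

Lemma dual_scale_continuous (a : K) f : continuous (a \*: f : X -> K^o).
Proof.
by move=> v; apply: cvgZr; exact: dual_continuous.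
Qed.

Definition dual_scale (a : K) f : dual X := Dual (@dual_scale_continuous a f).

Lemma duality_map_scale (a : K) x f : 0 < a -> x != 0 -> duality_map x f ->
  duality_map (a *: x) (dual_scale a f).
Proof.
move=> a0 x0 /(duality_mapP _ x0)[fx f_le].
have na : `|a| = a by rewrite gtr0_norm.
apply/duality_mapP; first by rewrite scaler_eq0 negb_or gt_eqF.
split=> [|v] /=.
  rewrite linearZ/= normrZ na fx /GRing.scale/=; ring.
by rewrite !normrZ na -mulrA ler_pM2l.
Qed.

Lemma lipschitz_bound (T : X -> X) : Lip0 T ->
  exists2 M, 0 <= M & forall x y, `|T x - T y| <= M * `|x - y|.
Proof.
(* [lipschitz] provides the estimate for constants strictly above a threshold [M]; this one is above
   it and nonnegative. *)
move=> [_ [M [Mreal M_lip]]]; exists (`|M| + 1); first by rewrite addr_ge0.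
move=> x y; apply: (M_lip (`|M| + 1) _ (x, y)) => //.
by rewrite (le_lt_trans (real_ler_norm Mreal))// ltrDl.
Qed.

Lemma lipschitz_Lip0 (T : X -> X) M : T 0 = 0 -> 0 <= M ->
  (forall x y, `|T x - T y| <= M * `|x - y|) -> Lip0 T.
Proof.
move=> T0 M0 TM; split=> //; exists M; split; first exact: ger0_real.
move=> N MN [x y] _ /=; apply: le_trans (TM x y) _.
by rewrite ler_wpM2r// ltW.
Qed.

End Duality.

(** * Numerical quotients under perturbation and restriction to chords *)

Section NonDensity.
Variables (R : realType) (K : numFieldType) (j : real_part R K).
Variable X : normedModType K.
Implicit Types (S T : X -> X) (p : X * X * dual X).

Lemma Lip0B S T : Lip0 S -> Lip0 T -> Lip0 (S \- T).
Proof.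
move=> S_lip T_lip; have [M M0 SM] := lipschitz_bound S_lip.
have [N N0 TN] := lipschitz_bound T_lip.
apply: lipschitz_Lip0 (addr_ge0 M0 N0) _ => [|x y].
  by rewrite /= S_lip.1 T_lip.1 subrr.
rewrite /= mulrDl (_ : S x - T x - (S y - T y) = (S x - S y) - (T x - T y)).
  by apply: le_trans (ler_normB _ _) _; exact: lerD (SM _ _) (TN _ _).
by rewrite !opprD !opprK addrACA.
Qed.

Lemma lip_norm_bound T : Lip0 T ->
  forall x y, `|T x - T y| <= lip_norm T * `|x - y|.
Proof.
move=> /lipschitz_bound[M M0 TM] x y.
have [->|xy] := eqVneq x y; first by rewrite !subrr !normr0 mulr0.
have nxy (z w : X) : z != w -> 0 < `|z - w| by rewrite normr_gt0 subr_eq0.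
rewrite -ler_pdivrMr ?nxy//; apply: (supremum_ubound j).
- by move=> _ [q _ <-]; rewrite divr_ge0.
- by exists M => _ [q /= q12 <-]; rewrite ler_pdivrMr ?nxy.
- by exists (x, y).
Qed.

Lemma lip_state_norm p : lip_states p ->
  0 < `|p.1.1 - p.1.2| /\
  forall v, `|p.2 v| <= `|p.1.1 - p.1.2| * `|v|.
Proof.
move=> [p12 /duality_mapP[|_ p2_le]]; first by rewrite subr_eq0.
by rewrite normr_gt0 subr_eq0.
Qed.

Lemma lip_quotient_bound T p M : lip_states p -> 0 <= M ->
  (forall x y, `|T x - T y| <= M * `|x - y|) -> lip_quotient T p <= M.
Proof.
move=> /lip_state_norm[n0 p2_le] M0 TM.
rewrite /lip_quotient ler_pdivrMr ?exprn_gt0//.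
apply: le_trans (p2_le _) _.
by rewrite expr2 mulrCA ler_pM2l.
Qed.

Lemma lip_quotient_le_radius T p : Lip0 T -> lip_states p ->
  lip_quotient T p <= lip_numerical_radius T.
Proof.
move=> /lipschitz_bound[M M0 TM] sp; apply: (supremum_ubound j).
- by move=> _ [q _ <-]; rewrite divr_ge0// exprn_ge0.
- by exists M => _ [q sq <-]; exact: lip_quotient_bound.
- by exists p.
Qed.

(** At a fixed state the quotient is a seminorm in the map, dominated by [lip_norm]. *)
Lemma lip_quotientB S T p : Lip0 S -> Lip0 T -> lip_states p ->
  lip_quotient S p <= lip_quotient T p + lip_norm (S \- T) /\
  lip_quotient T p <= lip_quotient S p + lip_norm (S \- T).
Proof.
move=> S_lip T_lip sp; have D_lip := Lip0B S_lip T_lip.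
have [n0 _] := lip_state_norm sp.
have : lip_quotient (S \- T) p <= lip_norm (S \- T).
  apply: lip_quotient_bound => //; last exact: lip_norm_bound.
  (* Nonnegativity of [lip_norm] is read off its bound at the two distinct points of [p]. *)
  by rewrite -(pmulr_lge0 _ n0); apply: le_trans (lip_norm_bound D_lip _ _).
rewrite /lip_quotient => D_le.
have SE : p.2 (S p.1.1 - S p.1.2) =
    p.2 (T p.1.1 - T p.1.2) + p.2 ((S \- T) p.1.1 - (S \- T) p.1.2).
  by rewrite -linearD/= addrACA subrKC -opprD subrKC.
split.
  rewrite -lerBlDl; apply: le_trans D_le; rewrite lerBlDl.
  by rewrite -mulrDl ler_pM2r ?invr_gt0 ?exprn_gt0// SE ler_normD.
rewrite -lerBlDl; apply: le_trans D_le; rewrite lerBlDl.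
rewrite -mulrDl ler_pM2r ?invr_gt0 ?exprn_gt0//.
rewrite -[in leLHS](addrK (p.2 ((S \- T) p.1.1 - (S \- T) p.1.2)) (p.2 _)) -SE.
exact: ler_normB.
Qed.

(** The chord is [t - s] times the original difference, and the duality map is homogeneous, so the
    functional shrinks by the same factor. Parameter 1 is the first point of [p], parameter 0 the
    second. *)
Definition segment_state p (s t : K) : X * X * dual X :=
  (p.1.2 + t *: (p.1.1 - p.1.2), p.1.2 + s *: (p.1.1 - p.1.2),
   dual_scale (t - s) p.2).

Lemma segment_stateP p s t : s < t -> lip_states p ->
  lip_states (segment_state p s t).
Proof.
move=> st [p12 dp]; have d0 : p.1.1 - p.1.2 != 0 by rewrite subr_eq0.
have st0 : 0 < t - s by rewrite subr_gt0.
have E : (segment_state p s t).1.1 - (segment_state p s t).1.2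
    = (t - s) *: (p.1.1 - p.1.2).
  by rewrite /= scalerBl opprD addrACA subrr add0r.
split; last by rewrite E; exact: duality_map_scale.
by rewrite -subr_eq0 E scaler_eq0 negb_or d0 gt_eqF.
Qed.

(* Both endpoint differences are bounded by the radius times their length, so
   equality on the whole segment leaves no slack on any part of it. *)
Lemma attained_on_segment T p s t : Lip0 T -> lip_states p ->
  lip_quotient T p = lip_numerical_radius T ->
  0 <= s -> s < t -> t <= 1 ->
  lip_numerical_radius T <= lip_quotient T (segment_state p s t).
Proof.
move=> T_lip sp; set nu := lip_numerical_radius T => attained s0 st t1.
set d := p.1.1 - p.1.2; have [n0 _] := lip_state_norm sp.
pose phi (r : K) := p.2 (T (p.1.2 + r *: d)).
have quotE r q : r < q -> lip_quotient T (segment_state p r q)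
    = `|phi q - phi r| / ((q - r) * `|d| ^+ 2).
  move=> rq; have qr0 : 0 < q - r by rewrite subr_gt0.
  rewrite /lip_quotient /= -/d.
  have -> : p.1.2 + q *: d - (p.1.2 + r *: d) = (q - r) *: d.
    by rewrite scalerBl opprD addrACA subrr add0r.
  rewrite !normrZ (gtr0_norm qr0) linearB -/(phi q) -/(phi r).
  by field; rewrite !gt_eqF.
(* Equality is allowed because the outer pieces [[0, s]] and [[t, 1]] may degenerate. *)
have phi_le r q : r <= q -> `|phi q - phi r| <= nu * ((q - r) * `|d| ^+ 2).
  rewrite le_eqVlt => /predU1P[->|rq]; first by rewrite !subrr normr0 mul0r mulr0.
  rewrite -ler_pdivrMr ?mulr_gt0 ?subr_gt0 ?exprn_gt0// -quotE//.
  by apply: lip_quotient_le_radius => //; exact: segment_stateP.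
rewrite quotE// ler_pdivlMr ?mulr_gt0 ?subr_gt0 ?exprn_gt0//.
have phi01 : `|phi 1 - phi 0| = nu * `|d| ^+ 2.
  rewrite -attained /lip_quotient -/d divfK ?gt_eqF ?exprn_gt0//.
  by rewrite /phi scale1r scale0r addr0 subrKC -linearB.
have : nu * `|d| ^+ 2 <= nu * ((1 - t) * `|d| ^+ 2) + `|phi t - phi s|
    + nu * ((s - 0) * `|d| ^+ 2).
  rewrite -phi01 (_ : _ - _ = (phi 1 - phi t) + (phi t - phi s) + (phi s - phi 0)).
    apply: le_trans (ler_normD _ _) _; apply: lerD; last exact: phi_le.
    by apply: le_trans (ler_normD _ _) _; apply: lerD => //; exact: phi_le.
  by rewrite !addrA !subrK.
rewrite -lerBlDr -lerBlDl => h; apply: le_trans h.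
by rewrite le_eqVlt; apply/orP; left; apply/eqP; ring.
Qed.

(** * A map far from all radius-attaining maps *)

Lemma lip_radius_attaining_not_dense :
  ~ lip_dense [set T : X -> X | Lip0 T /\ attains_lip_numerical_radius T].
Proof.
move=> dense.
(* A single attaining map provides a vector with a nonempty duality set, hence
   no Hahn-Banach argument is needed. *)
have [a [b [u state_u]]] : exists a b u, @lip_states K X (a, b, u).
  have Lip0_0 : Lip0 (fun _ : X => 0 : X).
    by apply: (@lipschitz_Lip0 K X _ 0) => // x y; rewrite subrr normr0 mul0r.
  have [T [_ [[[a b] u] st _]] _] := dense _ Lip0_0 1 ltr01.
  by exists a, b, u.
have [e0 ue] := state_u; move: e0 ue => /=; set e := a - b => ab dual_u.
have e0 : e != 0 by rewrite subr_eq0.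
have ne : 0 < `|e| by rewrite normr_gt0.
have /(duality_mapP _ e0)[ue u_le] := dual_u.
have state_e : lip_states (e, 0, u) by split; rewrite /= ?subr0.
have [f [f0 f1 f_lip f_flat]] := fat_cantor_function R.
(* A real-linear coordinate along [e], normalised to 1 at [e]; its slope bound [1 / |e|] is what
   makes [S] 1-Lipschitz. *)
pose rho (v : X) := re j (u v / `|e| ^+ 2).
have rhoB v w : rho v - rho w = rho (v - w).
  by rewrite /rho -reB -mulrBl -linearB.
have re0 : re j 0 = 0 by rewrite -[X in re j X](subrr 0) reB subrr.
have rho0 : rho 0 = 0 by rewrite /rho linear0 mul0r.
have rhoe : rho e = 1.
  rewrite /rho ue divff ?expf_neq0 ?gt_eqF//.
  by apply: (fmorph_inj j); rewrite of_real_re ?rmorph1.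
have rho_le v : j `|rho v| <= `|v| / `|e|.
  apply: le_trans (re_norm _ _) _.
  rewrite normrM normfV normrX normr_id ler_pdivrMr ?exprn_gt0//.
  apply: le_trans (u_le v) _; rewrite expr2 mulrA divfK ?gt_eqF//.
  by rewrite mulrC.
have rho_line x d r : rho (x + j r *: d) = rho x + r * rho d.
  rewrite [RHS]addrC; apply/eqP; rewrite -subr_eq rhoB; apply/eqP.
  by rewrite (addrC x) addrK /rho linearZ/= -mulrA reMl.
pose S v := j (f (rho v)) *: e.
have S_lip : Lip0 S.
  apply: (@lipschitz_Lip0 K X _ 1) => // [|v w].
    by rewrite /S rho0 f0 rmorph0 scale0r.
  rewrite -scalerBl -rmorphB normrZ of_real_norm mul1r -ler_pdivlMr//.
  apply: le_trans (rho_le _); rewrite of_real_le -rhoB; exact: f_lip.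
have Se : lip_quotient S (e, 0, u) = j (f 1).
  rewrite /lip_quotient /S /= rhoe rho0 f0 rmorph0 scale0r !subr0.
  rewrite linearZ/= ue normrZ normrX normr_id mulfK ?expf_neq0 ?gt_eqF//.
  by rewrite of_real_norm gtr0_norm.
(* Half of the quotient of [S] at [(e, 0, u)]: a closer [T] has quotient above [f 1 / 2] there,
   whereas attainment will force its radius to be at most [f 1 / 2]. *)
have f1_half : 0 < j (f 1 / 2) by rewrite -(rmorph0 j) of_real_lt divr_gt0.
have [T [T_lip [p sp attained]] ST] := dense _ S_lip _ f1_half.
(* [rho] is affine along the segment of [p], possibly with slope 0, so [S] takes equal values at two
   of its points. *)
have [s [t [s0 st t1 Sst]]] :=
  constant_chord f_flat (rho p.1.2) (rho (p.1.1 - p.1.2)).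
have jst : j s < j t by rewrite of_real_lt.
have sp_st := segment_stateP jst sp.
have Squot : lip_quotient S (segment_state p (j s) (j t)) = 0.
  by rewrite /lip_quotient /S /= !rho_line Sst subrr linear0 scaler0 normr0 mul0r.
have nu_le : lip_numerical_radius T <= j (f 1 / 2).
  apply: le_trans (attained_on_segment T_lip sp attained _ jst _) _.
  - by rewrite -(rmorph0 j) of_real_le.
  - by rewrite -(rmorph1 j) of_real_le.
  apply: le_trans (lip_quotientB S_lip T_lip sp_st).2 _.
  by rewrite Squot add0r ltW.
have := (lip_quotientB S_lip T_lip state_e).1.
rewrite Se => jf1_le.
suff : j (f 1) < j (f 1) by rewrite ltxx.
apply: (le_lt_trans jf1_le); rewrite [in ltRHS](splitr (f 1)) rmorphD; apply: ler_ltD => //.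
exact: le_trans (lip_quotient_le_radius T_lip state_e) nu_le.
Qed.

End NonDensity.

(** * The real and complex scalar fields *)

Lemma real_part_realType (R : realType) : real_part R R.
Proof.
exists (GRing.RMorphism.clone _ _ (@idfun R) _) id => //=.
Qed.

Lemma real_part_complex (R : realType) : real_part R R[i].
Proof.
exists (GRing.RMorphism.clone _ _ (@real_complex R) _) (@complex.Re R) => /=.
- by move=> x y; rewrite lecE/= eqxx.
- by move=> [a b] [c d].
- by move=> a [b c] /=; rewrite mul0r subr0.
- by move=> z /ger0_real; exact: RRe_real.
- exact: normc_ge_Re.
Qed.

Theorem theorem2p4 (R : realType) :
  (forall X : completeNormedModType R,
     ~ lip_dense [set T : X -> X | Lip0 T /\ attains_lip_numerical_radius T]) /\
  (forall X : completeNormedModType R[i],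
     ~ lip_dense [set T : X -> X | Lip0 T /\ attains_lip_numerical_radius T]).
Proof.
split=> X.
- exact: (lip_radius_attaining_not_dense (real_part_realType R)).
- exact: (lip_radius_attaining_not_dense (real_part_complex R)).
Qed.
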